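(* Let $\pi_n=\lambda_n n^{-\eta_s}$ with $\lambda_n\to 0$ and $\pi_n n^{\alpha}\to\infty$. Consider $\mathrm{NR}_n(\mathbf w,\pi_n)$, let $(|\mathscr C_{(i)}(\pi_n)|)_{i\ge1}$ be its component sizes in non-increasing order (ties broken arbitrarily) and $W_{(i)}(\pi_n)=\sum_{j\in\mathscr C_{(i)}(\pi_n)}w_j$ the corresponding component weights. Then for every fixed $i\ge 1$, as $n\to\infty$, $$\frac{|\mathscr C_{(i)}(\pi_n)|}{n^{\alpha}\pi_n}\xrightarrow{\mathbb P} c_{\mathrm F}\, i^{-\alpha}\qquad\text{and}\qquad \frac{W_{(i)}(\pi_n)}{n^{\alpha}}\xrightarrow{\mathbb P} c_{\mathrm F}\, i^{-\alpha}.$$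
   Context: Fix $\tau\in(2,3)$ and set $\alpha=1/(\tau-1)$, $\eta_s=(3-\tau)/2$. Let $F$ be a distribution function with $1-F(w)=Cw^{-(\tau-1)}$ on its support for some $C>0$, and for $n\ge1$ set $w_i=[1-F]^{-1}(i/n)$, $i\in[n]$; then $n^{-\alpha}w_i=c_{\mathrm F}i^{-\alpha}$ for a constant $c_{\mathrm F}>0$. Let $\ell_n=\sum_{i\in[n]}w_i$. The Norros–Reittu graph $\mathrm{NR}_n(\mathbf w)$ on vertex set $[n]$ contains each edge $\{i,j\}$ independently with probability $1-e^{-w_iw_j/\ell_n}$; $\mathrm{NR}_n(\mathbf w,\pi)$ is obtained from it by retaining each edge independently with probability $\pi$, independently of the graph. *)

(* Defs.v *)
From HB Require Import structures.
From mathcomp Require Import all_boot all_order all_algebra.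
From mathcomp Require Import all_classical all_reals all_analysis.
Set Implicit Arguments. Unset Strict Implicit. Unset Printing Implicit Defensive.
Import Order.TTheory GRing.Theory Num.Theory.
Local Open Scope ring_scope.

Section NR.
Variable R : realType.

Definition alpha_of (tau : R) : R := (tau - 1)^-1.
Definition eta_s (tau : R) : R := (3 - tau) / 2.

(* 1 - F(w) = C w^{-(tau-1)} on the support; the generalized inverse gives
   w_i = [1-F]^{-1}(i/n) = (C n / i)^alpha = c_F (n/i)^alpha with c_F = C^alpha.
   Vertex i in [n] = {1,...,n} is represented by k : 'I_n with i = k+1. *)
Definition cF (tau C : R) : R := C `^ alpha_of tau.

Definition weight (tau C : R) (n : nat) (k : 'I_n) : R :=
  cF tau C * ((n%:R / (k.+1)%:R) `^ alpha_of tau).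

Definition elln (tau C : R) (n : nat) : R := \sum_(k < n) weight tau C k.

Definition nr_prob (tau C : R) (n : nat) (i j : 'I_n) : R :=
  1 - expR (- (weight tau C i * weight tau C j / elln tau C n)).

Definition bern (p : R) (b : bool) : R := if b then p else 1 - p.

(* Outcome: for each pair (i,j) with i < j, a pair of booleans
   (edge present in NR_n(w), edge retained by percolation). Entries with
   ~~ (i < j) are dummies forced to (false,false). *)
Definition outcome (n : nat) := {ffun 'I_n * 'I_n -> bool * bool}.

Definition mass (tau C pi : R) (n : nat) (om : outcome n) : R :=
  \prod_(ij : 'I_n * 'I_n)
     (if (ij.1 < ij.2)%N
      then bern (nr_prob tau C ij.1 ij.2) (om ij).1 * bern pi (om ij).2
      else (if om ij == (false, false) then 1 else 0)).

Definition Prob (tau C pi : R) (n : nat) (A : pred (outcome n)) : R :=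
  \sum_(om | A om) mass tau C pi om.

Definition pedge n (om : outcome n) (i j : 'I_n) : bool :=
  (om (i, j)).1 && (om (i, j)).2.

Definition adj n (om : outcome n) : rel 'I_n :=
  fun x y => if (x < y)%N then pedge om x y
             else if (y < x)%N then pedge om y x else false.

Definition components n (om : outcome n) : {set {set 'I_n}} :=
  [set [set y | connect (adj om) x y] | x in [set: 'I_n]].

Definition sorted_components n (om : outcome n) (l : seq {set 'I_n}) : Prop :=
  [/\ uniq l, (forall A, (A \in l) = (A \in components om))
    & sorted (fun A B : {set 'I_n} => #|B| <= #|A|)%N l].

(* i-th largest component (i >= 1); empty set if there are fewer than i *)
Definition Cth n (l : seq {set 'I_n}) (i : nat) : {set 'I_n} := nth (finset.set0 : {set 'I_n}) l i.-1.

Definition Wof (tau C : R) n (A : {set 'I_n}) : R := \sum_(j in A) weight tau C j.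

End NR.

(* Main.v *)
Require Import Defs.
From HB Require Import structures.
From mathcomp Require Import all_boot all_order all_algebra.
From mathcomp Require Import all_classical all_reals all_analysis.
From mathcomp Require Import ring lra zify.
Set Implicit Arguments. Unset Strict Implicit. Unset Printing Implicit Defensive.
Import Order.TTheory GRing.Theory Num.Theory.
Local Open Scope ring_scope.

(** The component of a hub [k] is essentially the star around it.  Write
    [q a b] for the probability of an edge after percolation.  Then
    [q a b <= pi min(1, w_a w_b / ell)], and the function [a^{-1/2}] satisfies
    [sum_b q a b b^{-1/2} <= const lam a^{-1/2}].  Since [lam -> 0], counting
    self-avoiding paths bounds the expected weight of the component of [k] by
    [w_k + o(n^alpha)], and its expected size by [1 + pi w_k + o(pi n^alpha)],
    because each path ends with one more edge, which costs a factor [pi w].  The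
    degree of [k] has mean [(1 - o(1)) pi w_k] and variance at most [pi w_k], so
    it fills this bound and the size concentrates.

    For components avoiding the first [K] vertices, the first moment is too weak.
    Count instead the ordered pairs joined by a path with at least one inner
    vertex: a component of size [s] contains at least [s (s - 2) / 4] of them,
    while their expected number is at most
    [pi^2 sum_{a > K} w_a V_a = O(pi^2 n^{2 alpha} K^{1/2 - alpha})], where [V_a]
    bounds the expected weight reachable from [a].  So for large [K] these
    components are smaller than those of any fixed hub, and the [i]-th largest
    component is that of vertex [i]. *)

(** * Percolation measure and self-avoiding paths *)

Lemma natr_bool_prod (R : comPzSemiRingType) (I : eqType) (s : seq I) (P : pred I) :
  (all P s)%:R = \prod_(i <- s) (P i)%:R :> R.
Proof.
elim: s => [|x s IH] /=; first by rewrite big_nil.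
by rewrite big_cons -IH -natrM mulnb.
Qed.

Section Percolation.
Variables (R : realType) (tau C pi : R) (n : nat).
Implicit Types (om : outcome n) (a b k : 'I_n) (s : seq 'I_n).

Local Notation w := (@weight R tau C n).
Local Notation ell := (elln tau C n).

(** One factor of [mass]. A dummy pair carries the point mass at [(false, false)], so every cell,
    real or dummy, has total mass 1. *)
Definition cell (e : 'I_n * 'I_n) (x : bool * bool) : R :=
  if (e.1 < e.2)%N then bern (nr_prob tau C e.1 e.2) x.1 * bern pi x.2
  else (if x == (false, false) then 1 else 0).

Definition Exp (f : outcome n -> R) : R := \sum_om mass tau C pi om * f om.

(** Also defined on the diagonal, where there is no edge: upper bounds may sum over all [b], while
    exact formulas must exclude [b = a]. *)
Definition qprob a b : R := nr_prob tau C a b * pi.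

Lemma weight_ge0 a : 0 <= w a.
Proof. by rewrite mulr_ge0 // powR_ge0. Qed.

Lemma elln_ge0 : 0 <= ell.
Proof. by apply: sumr_ge0 => a _; exact: weight_ge0. Qed.

Lemma nr_prob_ge0 a b : 0 <= nr_prob tau C a b.
Proof.
rewrite subr_ge0 -[X in _ <= X]expR0 ler_expR oppr_le0.
by rewrite mulr_ge0 ?invr_ge0 ?elln_ge0 // mulr_ge0 // weight_ge0.
Qed.

Lemma nr_prob_le1 a b : nr_prob tau C a b <= 1.
Proof. by rewrite lerBlDr lerDl expR_ge0. Qed.

Lemma nr_prob_le a b : nr_prob tau C a b <= w a * w b / ell.
Proof. by rewrite /nr_prob; have := expR_ge1Dx (- (w a * w b / ell)); lra. Qed.

Lemma qprobC a b : qprob a b = qprob b a.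
Proof. by rewrite /qprob /nr_prob [w a * _]mulrC. Qed.

Lemma sum_cell e : \sum_x cell e x = 1.
Proof.
rewrite -(pair_bigA _ (fun x y => cell e (x, y))) /= ?big_bool /= ?big_bool /cell /bern /=.
by case: ifP => _; ring.
Qed.

Lemma sum_cell_open (e : 'I_n * 'I_n) : (e.1 < e.2)%N ->
  \sum_x cell e x * (x.1 && x.2)%:R = qprob e.1 e.2.
Proof.
move=> lte.
rewrite -(pair_bigA _ (fun x y => cell e (x, y) * (x && y)%:R)) /= ?big_bool /= ?big_bool.
by rewrite /cell /bern lte /= /qprob; ring.
Qed.

Lemma qprob_ge0 a b : 0 <= pi <= 1 -> 0 <= qprob a b.
Proof. by case/andP=> pi0 _; rewrite mulr_ge0 ?nr_prob_ge0 //. Qed.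

Lemma qprob_le a b : 0 <= pi <= 1 -> qprob a b <= pi * (w a * w b / ell).
Proof. by case/andP=> pi0 _; rewrite /qprob mulrC ler_wpM2l ?nr_prob_le //. Qed.

Lemma qprob_le_pi a b : 0 <= pi <= 1 -> qprob a b <= pi.
Proof. by case/andP=> pi0 _; rewrite /qprob ler_piMl ?nr_prob_le1 //. Qed.

(** Independence of the pairs: [mass] is a product, so distributivity turns the sum over outcomes
    into a product of sums. *)
Lemma Exp_prod (g : 'I_n * 'I_n -> bool * bool -> R) :
  Exp (fun om => \prod_e g e (om e)) = \prod_e \sum_x cell e x * g e x.
Proof.
by rewrite bigA_distr_bigA /=; apply: eq_bigr => om _; rewrite -big_split.
Qed.

Lemma Exp_cst c : Exp (fun=> c) = c.
Proof.
have E1 : Exp (fun=> 1) = 1.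
  transitivity (Exp (fun om => \prod_e (fun _ _ => 1) e (om e))).
    by apply: eq_bigr => om _; rewrite big1_eq.
  rewrite (Exp_prod (fun _ _ => 1)) big1 // => e _; rewrite -[RHS](sum_cell e).
  by apply: eq_bigr => x _; rewrite mulr1.
rewrite -[RHS]mul1r -E1 /Exp mulr_suml; apply: eq_bigr => om _.
by rewrite mulr1.
Qed.

Lemma ExpD f g : Exp (fun om => f om + g om) = Exp f + Exp g.
Proof. by rewrite /Exp -big_split; apply: eq_bigr => om _; rewrite mulrDr. Qed.

Lemma ExpZ c f : Exp (fun om => c * f om) = c * Exp f.
Proof. by rewrite /Exp mulr_sumr; apply: eq_bigr => om _; rewrite mulrCA. Qed.

Lemma Exp_sum (I : Type) (r : seq I) (P : pred I) (f : I -> outcome n -> R) :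
  Exp (fun om => \sum_(i <- r | P i) f i om) = \sum_(i <- r | P i) Exp (f i).
Proof.
by rewrite /Exp exchange_big; apply: eq_bigr => om _; rewrite mulr_sumr.
Qed.

Lemma eq_Exp f g : f =1 g -> Exp f = Exp g.
Proof. by move=> fg; apply: eq_bigr => om _; rewrite fg. Qed.

Lemma Prob_Exp (A : pred (outcome n)) : Prob tau C pi A = Exp (fun om => (A om)%:R).
Proof.
rewrite /Prob /Exp big_mkcond; apply: eq_bigr => om _.
by case: (A om); rewrite ?mulr1 ?mulr0.
Qed.

Definition epair a b : 'I_n * 'I_n := if (a < b)%N then (a, b) else (b, a).

Definition eopen om (e : 'I_n * 'I_n) := (om e).1 && (om e).2.

Lemma adjE om a b : adj om a b = (a != b) && eopen om (epair a b).
Proof.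
rewrite /adj /epair /pedge /eopen -(inj_eq val_inj) neq_ltn /=.
by case: ltngtP.
Qed.

Lemma epairC a b : epair a b = epair b a.
Proof.
rewrite /epair; case: ltngtP => // ab; congr (_, _); exact/val_inj.
Qed.

Lemma adjC om a b : adj om a b = adj om b a.
Proof. by rewrite !adjE eq_sym epairC. Qed.

(** Pairs outside [L] contribute a factor 1. Uniqueness keeps an edge from being counted twice, and
    the order condition excludes dummy pairs. *)
Lemma Exp_open (L : seq ('I_n * 'I_n)) :
  uniq L -> all (fun e : 'I_n * 'I_n => e.1 < e.2)%N L ->
  Exp (fun om => (all (eopen om) L)%:R) = \prod_(e <- L) qprob e.1 e.2.
Proof.
move=> uL ltL.
pose g e (x : bool * bool) : R := if e \in L then (x.1 && x.2)%:R else 1.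
have -> : Exp (fun om => (all (eopen om) L)%:R) = Exp (fun om => \prod_e g e (om e)).
  apply: eq_Exp => om; rewrite natr_bool_prod big_uniq //= big_mkcond /=.
  by apply: eq_bigr => e _; rewrite /g; case: ifP.
rewrite Exp_prod (big_uniq _ uL) [RHS]big_mkcond /=; apply: eq_bigr => e _.
rewrite /g; case: ifP => [eL|_].
  by rewrite sum_cell_open //; exact: (allP ltL).
by rewrite -[RHS](sum_cell e); apply: eq_bigr => x _; rewrite mulr1.
Qed.

Fixpoint pedges a s := if s is b :: s' then epair a b :: pedges b s' else [::].

Fixpoint pweight a s : R := if s is b :: s' then qprob a b * pweight b s' else 1.

Lemma mem_pedges a s e : e \in pedges a s -> (e.1 \in a :: s) && (e.2 \in a :: s).
Proof.
elim: s a => [|b s IH] a //=; rewrite in_cons => /orP[/eqP->|/IH].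
  by rewrite /epair; case: ifP => _ /=; rewrite !inE !eqxx ?orbT.
by case/andP => h1 h2; rewrite in_cons h1 orbT in_cons h2 orbT.
Qed.

(** The first edge contains [a], while later edges have both ends in the rest of the path, which
    avoids [a]. *)
Lemma pedges_uniq a s : uniq (a :: s) -> uniq (pedges a s).
Proof.
elim: s a => [|b s IH] a //= /andP[aN u]; rewrite (IH _ u) andbT.
apply/negP => /mem_pedges; rewrite /epair; case: ifP => _ /= /andP[h1 h2].
  by rewrite h1 in aN.
by rewrite h2 in aN.
Qed.

Lemma pedges_lt a s : uniq (a :: s) -> all (fun e : 'I_n * 'I_n => e.1 < e.2)%N (pedges a s).
Proof.
elim: s a => [|b s IH] a //= /andP[aN u]; rewrite (IH _ u) andbT.
move: aN; rewrite in_cons negb_or => /andP[ab _].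
rewrite /epair; case: (ltngtP a b) => //= h.
by move: ab; rewrite -(inj_eq val_inj) /= h eqxx.
Qed.

Lemma path_adj_pedges om a s : uniq (a :: s) ->
  path (adj om) a s = all (eopen om) (pedges a s).
Proof.
elim: s a => [|b s IH] a //= /andP[aN u]; rewrite (IH _ u) adjE.
by move: aN; rewrite in_cons negb_or => /andP[->].
Qed.

Lemma prod_pedges a s :
  \prod_(e <- pedges a s) qprob e.1 e.2 = pweight a s.
Proof.
elim: s a => [|b s IH] a /=; first by rewrite big_nil.
rewrite big_cons IH.
suff -> : qprob (epair a b).1 (epair a b).2 = qprob a b by [].
by rewrite /epair; case: ifP => _; [reflexivity | exact: qprobC].
Qed.

Lemma Exp_path a s : uniq (a :: s) ->
  Exp (fun om => (path (adj om) a s)%:R) = pweight a s.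
Proof.
move=> u; rewrite -prod_pedges -Exp_open ?pedges_uniq ?pedges_lt //.
by apply: eq_Exp => om; rewrite path_adj_pedges.
Qed.

Lemma Exp_adj a b : a != b -> Exp (fun om => (adj om a b)%:R) = qprob a b.
Proof.
move=> ab; have := @Exp_path a [:: b]; rewrite /= inE ab mulr1 => <- //.
by apply: eq_Exp => om; rewrite andbT.
Qed.

(** The two edges form the self-avoiding path [a], [k], [b]. *)
Lemma Exp_adj2 k a b : k != a -> k != b -> a != b ->
  Exp (fun om => (adj om k a)%:R * (adj om k b)%:R) = qprob k a * qprob k b.
Proof.
move=> ka kb ab.
have u : uniq [:: a; k; b] by rewrite /= !inE negb_or eq_sym ka ab kb.
have := Exp_path u; rewrite /= mulr1 (qprobC a k) => <-.
by apply: eq_Exp => om; rewrite andbT adjC -natrM mulnb.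
Qed.

Lemma pweight_rcons a s b : pweight a (rcons s b) = pweight a s * qprob (last a s) b.
Proof.
elim: s a => [|c s IH] a /=; first by rewrite mulr1 mul1r.
by rewrite IH mulrA.
Qed.

Hypothesis pi01 : 0 <= pi <= 1.

Lemma pweight_ge0 a s : 0 <= pweight a s.
Proof. by elim: s a => [|b s IH] a //=; rewrite mulr_ge0 ?qprob_ge0. Qed.

Lemma sum_qprob_le a : \sum_b qprob a b <= pi * w a.
Proof.
(* If [ell] vanishes, its inverse is 0 by convention and [qprob_le] gives the bound 0. *)
have [ell0|ell0] := eqVneq ell 0.
  apply: (@le_trans _ _ 0); last by case/andP: pi01 => *; rewrite mulr_ge0 ?weight_ge0.
  apply: sumr_le0 => b _; apply: (le_trans (qprob_le _ _ pi01)).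
  by rewrite ell0 invr0 !mulr0.
apply: le_trans (ler_sum _ (fun b _ => qprob_le a b pi01)) _.
rewrite -mulr_sumr -mulr_suml -mulr_sumr.
by rewrite -mulrA divff // mulr1.
Qed.

Lemma mass_ge0 om : 0 <= mass tau C pi om.
Proof.
case/andP: pi01 => pi0 pi1.
apply: prodr_ge0 => e _; rewrite /bern.
have h1 := nr_prob_ge0 e.1 e.2; have h2 := nr_prob_le1 e.1 e.2.
case: ifP => _; last by case: ifP.
by apply: mulr_ge0; case: ifP => _ //; rewrite subr_ge0.
Qed.

Lemma le_Exp f g : (forall om, f om <= g om) -> Exp f <= Exp g.
Proof. by move=> fg; apply: ler_sum => om _; rewrite ler_wpM2l ?mass_ge0. Qed.

Lemma Prob_ge0 (A : pred (outcome n)) : 0 <= Prob tau C pi A.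
Proof. by apply: sumr_ge0 => om _; exact: mass_ge0. Qed.

Lemma le_Prob (A B : pred (outcome n)) : (forall om, A om -> B om) ->
  Prob tau C pi A <= Prob tau C pi B.
Proof.
move=> AB; rewrite !Prob_Exp; apply: le_Exp => om.
by rewrite ler_nat; have := AB om; case: (A om) => // ->.
Qed.

Lemma Prob_or (A B : pred (outcome n)) :
  Prob tau C pi (fun om => A om || B om) <= Prob tau C pi A + Prob tau C pi B.
Proof.
rewrite !Prob_Exp -ExpD; apply: le_Exp => om; rewrite -natrD ler_nat.
by case: (A om); case: (B om).
Qed.

Lemma Prob_has (I : eqType) (r : seq I) (A : I -> pred (outcome n)) :
  Prob tau C pi (fun om => has (fun i => A i om) r) <= \sum_(i <- r) Prob tau C pi (A i).
Proof.
under eq_bigr do rewrite Prob_Exp.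
rewrite Prob_Exp -Exp_sum; apply: le_Exp => om.
elim: r => [|i r IH] /=; first by rewrite big_nil.
rewrite big_cons; apply: le_trans (lerD (lexx _) IH).
by rewrite -natrD ler_nat; case: (A i om) => //=; case: (has _ _).
Qed.

Lemma Prob_markov (A : pred (outcome n)) (f : outcome n -> R) (t : R) : 0 < t ->
  (forall om, 0 <= f om) -> (forall om, A om -> t <= f om) ->
  Prob tau C pi A <= Exp f / t.
Proof.
move=> t0 f0 Af; rewrite ler_pdivlMr // mulrC Prob_Exp -ExpZ; apply: le_Exp => om.
by have := Af om; case: (A om) => [/(_ isT)|_]; rewrite ?mulr1 ?mulr0.
Qed.

End Percolation.

(** * Path counting *)

Lemma ler1_sum_mem (R : numDomainType) (I : eqType) (r : seq I) (P : pred I) (i : I) :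
  i \in r -> P i -> 1 <= \sum_(j <- r) (P j)%:R :> R.
Proof.
elim: r => [|x r IH] //=; rewrite in_cons big_cons => /orP[/eqP<- ->|ir Pi].
  by rewrite lerDl sumr_ge0.
by rewrite (le_trans (IH ir Pi)) // lerDr.
Qed.

Section Paths.
Variables (R : realType) (tau C pi : R) (n : nat).
Hypothesis pi01 : 0 <= pi <= 1.
Implicit Types (om : outcome n) (a b j k : 'I_n) (s : seq 'I_n).

Local Notation w := (@weight R tau C n).
Local Notation ell := (elln tau C n).
Local Notation E := (@Exp R tau C pi n).
Local Notation q := (qprob tau C pi).
Local Notation pw := (pweight tau C pi).

Fixpoint seqs m : seq (seq 'I_n) :=
  if m is m'.+1 then [::] :: [seq b :: s | b <- enum 'I_n, s <- seqs m']
  else [:: [::]].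

(** A truncated Neumann series of the kernel [q] applied to [w]. It runs over all vertex sequences,
    self-avoiding or not, and so satisfies the recursion [VsumS]. *)
Definition Vsum m a : R := \sum_(s <- seqs m) pw a s * w (last a s).

Definition component_of om a : {set 'I_n} := [set y | connect (adj om) a y].

Definition spath om a s := path (adj om) a s && uniq (a :: s).

Definition deg om k : R := \sum_(j | j != k) (adj om k j)%:R.

Lemma mem_seqs m s : (size s <= m)%N -> s \in seqs m.
Proof.
elim: m s => [|m IH] [|b s] //= sm.
by rewrite in_cons; apply/orP; right; apply/allpairsP; exists (b, s); rewrite mem_enum IH.
Qed.

Lemma VsumS m a : Vsum m.+1 a = w a + \sum_b q a b * Vsum m b.
Proof.
rewrite /Vsum /= big_cons /= mul1r; congr (_ + _).
rewrite big_allpairs_dep big_enum; apply: eq_bigr => b _.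
by rewrite mulr_sumr; apply: eq_bigr => s _; rewrite mulrA.
Qed.

(** A sequence with repetitions makes the left side 0, so later sums need not be restricted to
    self-avoiding sequences. *)
Lemma Exp_spath a s : E (fun om => (spath om a s)%:R) <= pw a s.
Proof.
rewrite /spath; have [u|u] := boolP (uniq (a :: s)); last first.
  under eq_Exp do rewrite andbF.
  by rewrite Exp_cst pweight_ge0.
by rewrite -(@Exp_path R tau C pi) //; apply: le_Exp => // om; rewrite andbT.
Qed.

Lemma spath_size om a s : spath om a s -> (size s < n)%N.
Proof.
case/andP=> _ /card_uniqP /= us.
by rewrite -[X in (_ <= X)%N](card_ord n) -us max_card.
Qed.

Lemma connect_spath om a j : connect (adj om) a j ->
  exists2 s, spath om a s & j = last a s.
Proof.
case/connectP => p pP ->; case/shortenP: pP => s sP us _.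
by exists s => //; rewrite /spath sP us.
Qed.

Lemma spath_connect om a s x : spath om a s -> x \in a :: s -> connect (adj om) a x.
Proof. by case/andP=> sp _ xs; apply: (path_connect sp). Qed.

(** Each vertex of the component ends some self-avoiding path from [a], of fewer than [n] steps; the
    indicator of membership is bounded by the number of such paths. *)
Lemma Exp_Wof_component a : E (fun om => Wof tau C (component_of om a)) <= Vsum n a.
Proof.
apply: (@le_trans _ _ (E (fun om => \sum_(s <- seqs n) w (last a s) * (spath om a s)%:R))).
  apply: le_Exp => // om; rewrite /Wof big_mkcond /=.
  have -> : \sum_(s <- seqs n) w (last a s) * (spath om a s)%:R =
    \sum_j w j * \sum_(s <- seqs n) (spath om a s && (last a s == j))%:R.
    under [RHS]eq_bigr do rewrite mulr_sumr.
    rewrite exchange_big /=; apply: eq_bigr => s _.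
    rewrite (bigD1 (last a s)) //= eqxx andbT big1 ?addr0 // => j jl.
    by rewrite eq_sym (negbTE jl) andbF mulr0.
  apply: ler_sum => j _; rewrite inE; case: ifP => [cj|_]; last first.
    by rewrite mulr_ge0 ?weight_ge0 // sumr_ge0.
  have [s sp js] := connect_spath cj.
  rewrite ler_peMr ?weight_ge0 //.
  apply: (@ler1_sum_mem _ _ _ (fun s => spath om a s && (last a s == j)) s).
    by rewrite mem_seqs // ltnW // (spath_size sp).
  by rewrite sp js eqxx.
rewrite Exp_sum; apply: ler_sum => s _.
by rewrite ExpZ mulrC ler_wpM2r ?weight_ge0 ?Exp_spath.
Qed.

Lemma sum_pweight_rcons a s : \sum_k pw a (rcons s k) <= pi * (pw a s * w (last a s)).
Proof.
under eq_bigr do rewrite pweight_rcons.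
rewrite -mulr_sumr mulrCA ler_wpM2l ?pweight_ge0 //.
exact: sum_qprob_le.
Qed.

(** Every vertex other than [a] is reached by a nonempty path. Summing over its last vertex costs
    [pi] times the weight of the vertex before, which turns a count of vertices into [pi] times a
    weight. *)
Lemma Exp_card_component_of a : E (fun om => #|component_of om a|%:R - 1) <= pi * Vsum n a.
Proof.
apply: (@le_trans _ _ (E (fun om => \sum_(s <- seqs n) \sum_k (spath om a (rcons s k))%:R))).
  apply: le_Exp => // om; rewrite exchange_big /=.
  rewrite (cardsD1 a) inE connect0 natrD [1%:R + _]addrC addrK.
  rewrite -sum1_card natr_sum big_mkcond /=; apply: ler_sum => j _.
  rewrite !inE; case: ifP => [/andP[ja cj]|_]; last by rewrite sumr_ge0.
  have [s sp js] := connect_spath cj.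
  case: (lastP s) sp js => [_ /= jE|s' x sp]; first by rewrite jE eqxx in ja.
  rewrite last_rcons => jE; rewrite -jE in sp.
  apply: (@ler1_sum_mem _ _ _ (fun s => spath om a (rcons s j)) s') => //.
  by apply: mem_seqs; have := spath_size sp; rewrite size_rcons; lia.
rewrite Exp_sum /Vsum mulr_sumr; apply: ler_sum => s _; rewrite Exp_sum.
by apply: le_trans (sum_pweight_rcons a s); apply: ler_sum => k _; exact: Exp_spath.
Qed.

(** Here [a] is the first inner vertex. Only [a] is required to lie outside the first [K] vertices;
    this already makes the first moment small. *)
Definition long_paths K om : R :=
  \sum_j \sum_k \sum_(a : 'I_n | (K <= a)%N) \sum_(s <- seqs n) (spath om j (a :: rcons s k))%:R.

(** Summing over [j] removes the first edge at cost [pi * w a], summing over [k] removes the last at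
    cost [pi] times the final weight, and the middle part adds up to [Vsum n a]. *)
Lemma Exp_long_paths K :
  E (long_paths K) <= pi ^+ 2 * \sum_(a : 'I_n | (K <= a)%N) w a * Vsum n a.
Proof.
have [pi0 pi1] := andP pi01.
rewrite /long_paths Exp_sum.
under eq_bigr do (rewrite Exp_sum; under eq_bigr do (rewrite Exp_sum; under eq_bigr do rewrite Exp_sum)).
apply: (@le_trans _ _ (\sum_j \sum_k \sum_(a : 'I_n | (K <= a)%N) \sum_(s <- seqs n) q j a * pw a (rcons s k))).
  apply: ler_sum => j _; apply: ler_sum => k _; apply: ler_sum => a _; apply: ler_sum => s _.
  exact: Exp_spath.
under eq_bigr do rewrite exchange_big.
rewrite exchange_big /= mulr_sumr; apply: ler_sum => a _.
have -> : \sum_j \sum_k \sum_(s <- seqs n) q j a * pw a (rcons s k) =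
   (\sum_j q a j) * \sum_(s <- seqs n) \sum_k pw a (rcons s k).
  rewrite mulr_suml; apply: eq_bigr => j _; rewrite exchange_big mulr_sumr.
  by apply: eq_bigr => s _; rewrite mulr_sumr; apply: eq_bigr => k _; rewrite (qprobC _ _ _ a j).
have -> : pi ^+ 2 * (w a * Vsum n a) = (pi * w a) * (pi * Vsum n a) by ring.
apply: ler_pM; rewrite ?sumr_ge0 //.
- by move=> b _; exact: qprob_ge0.
- by move=> s _; apply: sumr_ge0 => k _; exact: pweight_ge0.
- exact: sum_qprob_le.
- by rewrite /Vsum mulr_sumr; apply: ler_sum => s _; exact: sum_pweight_rcons.
Qed.

Lemma adj_sym_connect om : connect_sym (adj om).
Proof. by apply: sym_connect_sym => x y; exact: adjC. Qed.

Lemma components_eq om (A : {set 'I_n}) x : A \in components om -> x \in A -> A = component_of om x.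
Proof.
case/imsetP => y _ ->; rewrite inE => yx; apply/setP => z; rewrite !inE.
exact: (same_connect (@adj_sym_connect om) yx).
Qed.

Lemma component_ofP om x : component_of om x \in components om.
Proof. by apply/imsetP; exists x. Qed.

Lemma long_paths_ge K om (A B1 : {set 'I_n}) (B2 : 'I_n -> {set 'I_n}) :
  A \in components om -> (forall x, x \in A -> (K <= x)%N) ->
  B1 \subset A ->
  (forall j, j \in B1 -> forall k, k \in B2 j ->
     exists a, exists s, (a \in A) /\ spath om j (a :: rcons s k)) ->
  (\sum_(j in B1) #|B2 j|)%:R <= long_paths K om.
Proof.
clear pi01; move=> Ac AK B1A H; rewrite natr_sum big_mkcond /=; apply: ler_sum => j _.
have i0 k : 0 <= \sum_(a : 'I_n | (K <= a)%N) \sum_(s <- seqs n) (spath om j (a :: rcons s k))%:R :> R.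
  by apply: sumr_ge0 => a _; exact: sumr_ge0.
case: ifP => [jB|_]; last exact: sumr_ge0.
rewrite -sum1_card natr_sum big_mkcond /=; apply: ler_sum => k _.
case: ifP => [kB|_] //.
have [a [s [aA sp]]] := H j jB k kB.
rewrite (bigD1 a) ?AK //= -[1%:R]addr0 lerD //.
  apply: (@ler1_sum_mem _ _ _ (fun s => spath om j (a :: rcons s k)) s) => //.
  by apply: mem_seqs; have := spath_size sp; rewrite /= size_rcons; lia.
by apply: sumr_ge0 => b _; exact: sumr_ge0.
Qed.

(* Either all degrees in the component are at most half its size, and then the
   non-adjacent pairs are joined by long paths, or some vertex has larger degree,
   and then pairs of its neighbours are joined through it. *)
Lemma card_component_long_paths K om (A : {set 'I_n}) :
  A \in components om -> (forall x, x \in A -> (K <= x)%N) ->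
  (#|A| * (#|A| - 2))%:R <= 4 * long_paths K om.
Proof.
clear pi01; move=> Ac AK; pose N j := [set k | adj om j k].
have NA j : j \in A -> N j \subset A.
  move=> jA; rewrite (components_eq Ac jA); apply/fintype.subsetP => k; rewrite !inE.
  exact: connect1.
have jN j : j \notin N j by rewrite inE adjE eqxx.
have [/existsP[c /andP[cA dc]]|/existsPn small] := boolP [exists c, (c \in A) && (#|A| <= 2 * #|N c|)%N].
  have := @long_paths_ge K om A (N c) (fun j => N c :\ j) Ac AK (NA c cA).
  have -> : (\sum_(j in N c) #|N c :\ j| = #|N c| * (#|N c|.-1))%N.
    rewrite -sum_nat_const; apply: eq_bigr => j jN'.
    by rewrite (cardsD1 j (N c)) jN'.
  move=> H; apply: (@le_trans _ _ (4 * (#|N c| * #|N c|.-1)%:R)).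
    (* The choice of [c] bounds [#|A|] by [2 * #|N c|], hence [#|A| - 2] by [2 * (#|N c| - 1)]. *)
    by rewrite -natrM ler_nat; nia.
  rewrite ler_pM2l //; apply: H => j jN' k.
  rewrite in_setD1 => /andP[kj kN]; exists c, [::]; split => //.
  move: jN' kN; rewrite !inE /spath /= => cj ck; rewrite adjC cj ck /= !inE negb_or.
  by move: cj ck; rewrite !adjE => /andP[cj _] /andP[ck _]; rewrite eq_sym cj ck eq_sym kj.
have := @long_paths_ge K om A A (fun j => A :\: (j |: N j)) Ac AK (subxx _).
move=> H; apply: (@le_trans _ _ (4 * (\sum_(j in A) #|A :\: (j |: N j)|)%:R)).
  rewrite -natrM ler_nat big_distrr /= -sum_nat_const.
  apply: leq_sum => j jA; rewrite cardsD.
  have := small j; rewrite jA /= -ltnNge => sj.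
  set I1 := #|_ :&: _|; have : (I1 <= 1 + #|N j|)%N.
    by rewrite (leq_trans (subset_leq_card (subsetIr _ _))) // cardsU1 jN.
  by move: I1 #|A| #|N j| sj => I1 x y; lia.
rewrite ler_pM2l //; apply: H => j jA k.
rewrite !inE negb_or => /andP[/andP[kj jk] kA].
have : connect (adj om) j k by move: kA; rewrite {1}(components_eq Ac jA) inE.
case/connect_spath => s sp ks.
case: s sp ks => [|a s] sp /= ks; first by rewrite ks eqxx in kj.
have aA : a \in A.
  by rewrite (components_eq Ac jA) inE (spath_connect sp) // !inE eqxx orbT.
(* With [s] empty the path would be the single edge from [j] to [k], but [k] is outside [N j]. *)
case: (lastP s) sp ks => [|s' x] sp /= ks.
  by move: sp; rewrite /spath /= -ks (negbTE jk).
by rewrite last_rcons in ks; exists a, s'; split => //; rewrite ks.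
Qed.

Lemma Exp_deg k : E (deg^~ k) = \sum_(j | j != k) q k j.
Proof.
by rewrite /deg Exp_sum; apply: eq_bigr => j jk; rewrite Exp_adj // eq_sym.
Qed.

Lemma deg_lt_card_component_of om k : deg om k <= #|component_of om k|%:R - 1.
Proof.
rewrite (cardsD1 k) inE connect0 natrD [1%:R + _]addrC addrK.
rewrite /deg big_mkcond -sum1_card natr_sum [leRHS]big_mkcond /=; apply: ler_sum => j _.
rewrite !inE; case: (j == k) => //=; case: (boolP (adj om k j)) => [kj|_].
  by rewrite connect1.
by case: ifP.
Qed.

(** Independent indicators: the diagonal terms are [q - q ^+ 2], at most [q], and the covariances
    vanish by [Exp_adj2]. So the variance is at most the mean. *)
Lemma deg_variance k :
  E (fun om => (deg om k - \sum_(j | j != k) q k j) ^+ 2) <= pi * w k.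
Proof.
apply: (@le_trans _ _ (\sum_(j | j != k) q k j)); last first.
  rewrite (le_trans _ (@sum_qprob_le R tau C pi n pi01 k)) //.
  by rewrite [leRHS](bigD1 k) //= lerDr qprob_ge0.
pose Y j om : R := (adj om k j)%:R - q k j.
have -> : E (fun om => (deg om k - \sum_(j | j != k) q k j) ^+ 2) =
    \sum_(i | i != k) \sum_(j | j != k) E (fun om => Y i om * Y j om).
  under [RHS]eq_bigr do rewrite -Exp_sum.
  rewrite -Exp_sum; apply: eq_Exp => om; rewrite /deg -sumrB expr2 mulr_suml.
  by apply: eq_bigr => i _; rewrite mulr_sumr.
apply: ler_sum => i ik; rewrite (bigD1 i) //= big1 ?addr0.
  have -> : E (fun om => Y i om * Y i om) =
      E (fun om => (1 - 2 * q k i) * (adj om k i)%:R + q k i ^+ 2).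
    by apply: eq_Exp => om; rewrite /Y; case: (adj _ _ _) => /=; ring.
  rewrite ExpD ExpZ Exp_cst Exp_adj 1?eq_sym //.
  by have := sqr_ge0 (q k i); rewrite expr2; lra.
move=> j /andP[jk ji].
have ki : k != i by rewrite eq_sym.
have kj : k != j by rewrite eq_sym.
have ij : i != j by rewrite eq_sym.
have := Exp_adj2 tau C pi ki kj ij; have := Exp_adj tau C pi ki; have := Exp_adj tau C pi kj.
rewrite /Y; move: (q k i) (q k j) => x y Ey Ex Exy.
transitivity (E (fun om => (adj om k i)%:R * (adj om k j)%:R + (- y * (adj om k i)%:R +
         (- x * (adj om k j)%:R + x * y)))).
  by apply: eq_Exp => om; ring.
by rewrite !ExpD !ExpZ Exp_cst Exy Ex Ey; ring.
Qed.

End Paths.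

(** * Sums of real powers *)

Section RealPowers.
Variable R : realType.
Implicit Types (x y b M : R) (n : nat).

Lemma gt0_powRD x r s : 0 < x -> x `^ (r + s) = x `^ r * x `^ s.
Proof. by move=> x0; rewrite powRD // (gt_eqF x0) implybT. Qed.

Lemma gt0_powRV x r : 0 < x -> x^-1 `^ r = x `^ (- r).
Proof. by move=> x0; rewrite -[x^-1]powR_inv1 ?ltW // -powRrM mulN1r. Qed.

Lemma gt0_powRK x r : 0 < x -> x `^ r * x `^ (- r) = 1.
Proof. by move=> x0; rewrite -gt0_powRD // subrr powRr0. Qed.

Lemma ler_powRN x y r : 0 <= r -> 0 < x -> x <= y -> y `^ (- r) <= x `^ (- r).
Proof.
move=> r0 x0 xy; have y0 := lt_le_trans x0 xy.
rewrite !powRN lef_pV2 ?posrE ?powR_gt0 //.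
by apply: ge0_ler_powR; rewrite ?nnegrE // ltW.
Qed.

(** A discrete substitute for integrating [x ^ (- 1 - b)]: the right side telescopes in
    [sum_powR_tail]. *)
Lemma powRN_step x b : 0 < b -> 1 <= x ->
  x `^ (- 1 - b) <= (2 + b) / b * (x `^ (- b) - (x + 1) `^ (- b)).
Proof.
move=> b0 x1; have x0 : 0 < x by lra.
have x10 : 0 < x + 1 by lra.
have -> : (x + 1) `^ (- b) = x `^ (- b) * (1 + x^-1) `^ (- b).
  rewrite -powRM ?ltW ?addr_gt0 ?invr_gt0 //.
  by congr (_ `^ _); field; rewrite gt_eqF.
rewrite gt0_powRD // powR_inv1 ?(ltW x0) //.
have y0 : 0 < 1 + x^-1 by rewrite addr_gt0 ?invr_gt0.
pose u := b / (x + 1).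
have u0 : 0 < u by rewrite divr_gt0.
(* Write the power as an exponential, use [1 + y <= exp y], and bound the logarithm of [1 + 1/x]
   below by [1 / (x + 1)]. *)
have h : (1 + x^-1) `^ (- b) <= (1 + u)^-1.
  rewrite powRN lef_pV2 ?posrE ?powR_gt0 //; last by lra.
  rewrite /powR gt_eqF //; apply: le_trans (expR_ge1Dx _).
  rewrite lerD2l /u ler_wpM2l ?(ltW b0) //.
  have := @le_ln1Dx R (- (x + 1)^-1).
  have -> : 1 + - (x + 1)^-1 = (1 + x^-1)^-1.
    by field; rewrite !gt_eqF //=; lra.
  rewrite lnV ?posrE // lerN2; apply.
  by rewrite ltrN2 invf_lt1 //; lra.
(* After clearing denominators this reads [x + 1 + b <= (2 + b) * x], an equality at [x = 1]; hence
   the constant [2 + b]. *)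
have k : x^-1 <= (2 + b) / b * (1 - (1 + u)^-1).
  have -> : 1 - (1 + u)^-1 = b / (x + 1 + b).
    by rewrite /u; field; rewrite !gt_eqF //=; lra.
  have -> : (2 + b) / b * (b / (x + 1 + b)) = (2 + b) / (x + 1 + b).
    by field; rewrite !gt_eqF //=; lra.
  have xb0 : 0 < x + 1 + b by lra.
  rewrite ler_pdivlMr // ler_pdivrMl //.
  have : 0 <= (x - 1) * (1 + b) by rewrite mulr_ge0; lra.
  by lra.
have xb := powR_ge0 x (- b).
rewrite mulrC -[X in _ <= _ * (X - _)]mulr1 -mulrBr mulrCA ler_wpM2l //.
apply: le_trans k _; rewrite ler_wpM2l ?divr_ge0 ?addr_ge0 ?(ltW b0) //.
by rewrite lerD2l lerN2.
Qed.

(** The roots [s], [t] of [n + 1] and [n] satisfy [(s - t) * (s + t) = 1] and [s + t <= 2 * s]. *)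
Lemma sqrt_step n : n.+1%:R `^ (- 2^-1) <= 2 * (n.+1%:R `^ 2^-1 - n%:R `^ 2^-1) :> R.
Proof.
rewrite powRN !powR12_sqrt //.
set s := Num.sqrt _; set t := Num.sqrt _.
have s0 : 0 < s by rewrite sqrtr_gt0 ltr0n.
have t0 : 0 <= t by rewrite sqrtr_ge0.
have ts : t <= s by rewrite ler_sqrt ?ler_nat.
have e : s ^+ 2 = t ^+ 2 + 1 by rewrite !sqr_sqrtr // natr1.
rewrite -div1r ler_pdivrMr //; nra.
Qed.

Lemma sum_powR_head n M : 0 <= M ->
  \sum_(b < n | b.+1%:R <= M) b.+1%:R `^ (- 2^-1) <= 2 * M `^ 2^-1.
Proof.
move=> M0; elim: n => [|n IH]; first by rewrite big_ord0 mulr_ge0 ?powR_ge0.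
rewrite big_mkcond big_ord_recr /= -big_mkcond /=; case: ifP => [nM|_]; last by rewrite addr0.
apply: (@le_trans _ _ (2 * n.+1%:R `^ 2^-1)); last first.
  by rewrite ler_pM2l // ge0_ler_powR ?nnegrE.
have -> : \sum_(i < n | i.+1%:R <= M) i.+1%:R `^ (- 2^-1) = \sum_(i < n) i.+1%:R `^ (- 2^-1) :> R.
  apply: eq_bigl => i; apply: le_trans nM; rewrite ler_nat ltnS ltnW //.
rewrite -(@big_ord_recr _ _ _ n (fun i => (i : nat).+1%:R `^ (- 2^-1))) /=.
apply: (@le_trans _ _ (\sum_(i < n.+1) 2 * (i.+1%:R `^ 2^-1 - i%:R `^ 2^-1))).
  by apply: ler_sum => i _; exact: sqrt_step.
rewrite -mulr_sumr ler_pM2l //.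
rewrite -(big_mkord xpredT (fun i => i.+1%:R `^ 2^-1 - i%:R `^ 2^-1)) telescope_sumr //.
by rewrite lerBlDr lerDl powR_ge0.
Qed.

Lemma sum_powR_tail b n M : 0 < b -> 0 < M ->
  \sum_(i < n | M < i.+1%:R) i.+1%:R `^ (- 1 - b) <= (2 + b) / b * M `^ (- b).
Proof.
move=> b0 M0; pose c := (2 + b) / b.
have c0 : 0 < c by rewrite divr_gt0 // addr_gt0.
(* The induction must keep the end term of the telescope; the maximum with 0 covers small [n], where
   the sum is empty and the difference may be negative. *)
suff : \sum_(i < n | M < i.+1%:R) i.+1%:R `^ (- 1 - b)
     <= Num.max 0 (c * M `^ (- b) - c * n.+1%:R `^ (- b)).
  move=> h; apply: le_trans h _; rewrite ge_max mulr_ge0 ?powR_ge0 ?(ltW c0) //=.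
  by rewrite gerBl mulr_ge0 ?powR_ge0 ?(ltW c0).
elim: n => [|n IH]; first by rewrite big_ord0 le_max lexx.
have [Mn|nM] := ltP M n.+1%:R; last first.
  rewrite big_pred0 ?le_max ?lexx // => i; apply/negbTE; rewrite -leNgt.
  by apply: le_trans nM; rewrite ler_nat.
rewrite big_mkcond big_ord_recr /= -big_mkcond /= Mn.
have e : 0 <= c * M `^ (- b) - c * n.+1%:R `^ (- b).
  by rewrite subr_ge0 ler_pM2l // ler_powRN // ltW.
rewrite (max_idPr e) in IH.
have := powRN_step b0 (_ : 1 <= n.+1%:R); rewrite ler1n => /(_ isT).
rewrite natr1 -/c mulrBr => h.
by rewrite le_max; apply/orP; right; lra.
Qed.

(** From [expR (- x) <= 1 / (1 + x) = 1 - x + x^2 / (1 + x)], whose last term is at most both [x]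
    and [x^2]. The free exponent [p] lets [sum_nr_prob_ge] keep its error of order below [n^al]. *)
Lemma one_minus_expRN_ge x p : 0 <= x -> 1 <= p <= 2 -> x - x `^ p <= 1 - expR (- x).
Proof.
move=> x0 /andP[p1 p2].
have h : expR (- x) <= (1 + x)^-1.
  by rewrite expRN lef_pV2 ?posrE ?expR_gt0 ?expR_ge1Dx //; lra.
have [->|xn0] := eqVneq x 0.
  by rewrite powR0 ?oppr0 ?expR0 ?subrr //; apply/eqP; lra.
have xp : 0 < x by rewrite lt_neqAle eq_sym xn0.
have e : (1 + x)^-1 = 1 - x + x ^+ 2 / (1 + x) by field; rewrite gt_eqF //; lra.
suff : x ^+ 2 / (1 + x) <= x `^ p by lra.
have [x1|x1] := leP x 1.
  apply: (@le_trans _ _ (x ^+ 2)).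
    by rewrite ler_pdivrMr; nra.
  by rewrite -powR_mulrn // ger_powR ?xp.
apply: (@le_trans _ _ x); first by rewrite ler_pdivrMr; nra.
by apply: le1r_powR => //; lra.
Qed.

End RealPowers.

(** * Estimates for the weights *)

Section WeightEstimates.
Variables (R : realType) (tau C : R).
Hypothesis tau23 : 2 < tau < 3.
Hypothesis C0 : 0 < C.

Local Notation al := (alpha_of tau).
Local Notation c := (cF tau C).
Local Notation w := (weight tau C).

Lemma cF_gt0 : 0 < c.
Proof. exact: powR_gt0. Qed.

Lemma alpha_gt_half : 2^-1 < al.
Proof.
have [t2 t3] := andP tau23.
by rewrite /alpha_of ltf_pV2 ?posrE; lra.
Qed.

Lemma alpha_lt1 : al < 1.
Proof.
have [t2 t3] := andP tau23.
by rewrite /alpha_of invf_lt1; lra.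
Qed.

Lemma alpha_gt0 : 0 < al.
Proof. by apply: lt_trans alpha_gt_half; rewrite invr_gt0. Qed.

(** Multiplying [b^(-al)] by the test function [b^(-1/2)] gives [b^(-1 - beta)], a summable tail. *)
Definition beta : R := al - 2^-1.

Lemma beta_gt0 : 0 < beta.
Proof. by rewrite subr_gt0 alpha_gt_half. Qed.

Definition zeta_cst (b : R) : R := (2 + b) / b.

Lemma zeta_cst_gt0 b : 0 < b -> 0 < zeta_cst b.
Proof. by move=> b0; rewrite divr_gt0 // addr_gt0. Qed.

(** The 2 comes from [sum_powR_head], the other term from [sum_powR_tail]. *)
Definition kernel_cst : R := 2 + c * zeta_cst beta.

Lemma kernel_cst_gt0 : 0 < kernel_cst.
Proof. by rewrite addr_gt0 // mulr_gt0 ?cF_gt0 ?zeta_cst_gt0 ?beta_gt0. Qed.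

Section FixedSize.
Variable n : nat.
Hypothesis n0 : (0 < n)%N.
Implicit Types a b k : 'I_n.

Let nR0 : 0 < n%:R :> R. Proof. by rewrite ltr0n. Qed.
Let nR1 : 1 <= n%:R :> R. Proof. by rewrite ler1n. Qed.

Lemma weightE k : w k = c * (n%:R `^ al * k.+1%:R `^ (- al)).
Proof. by rewrite /weight powRM ?invr_ge0 // gt0_powRV // ltr0n. Qed.

Lemma elln_ge : c * n%:R <= elln tau C n.
Proof.
have -> : c * n%:R = \sum_(k < n) c by rewrite sumr_const card_ord mulr_natr.
apply: ler_sum => k _; rewrite ler_peMr ?(ltW cF_gt0) //.
apply: (@le_trans _ _ ((n%:R / k.+1%:R) `^ 0)); first by rewrite powRr0.
apply: ler_powR; last exact: (ltW alpha_gt0).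
by rewrite ler_pdivlMr ?ltr0n // mul1r ler_nat.
Qed.

Lemma elln_gt0 : 0 < elln tau C n.
Proof. by apply: lt_le_trans elln_ge; rewrite mulr_gt0 ?cF_gt0. Qed.

Lemma edge_ratio_le a b :
  w a * w b / elln tau C n <=
  c * n%:R `^ (2 * al - 1) * (a.+1%:R `^ (- al) * b.+1%:R `^ (- al)).
Proof.
apply: (@le_trans _ _ (w a * w b / (c * n%:R))).
  rewrite ler_wpM2l ?(mulr_ge0 (weight_ge0 _ _ _) (weight_ge0 _ _ _)) //.
  by rewrite lef_pV2 ?posrE ?elln_gt0 ?elln_ge // mulr_gt0 ?cF_gt0.
have -> : 2 * al - 1 = al + (al + -1) by ring.
rewrite !gt0_powRD // powR_inv1 // !weightE le_eqVlt; apply/orP; left; apply/eqP.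
by field; rewrite !gt_eqF ?cF_gt0.
Qed.

Definition hub_range a : R := n%:R `^ (3 - tau) / a.+1%:R.

Lemma hub_range_gt0 a : 0 < hub_range a.
Proof. by rewrite divr_gt0 ?powR_gt0 ?ltr0n. Qed.

Lemma hub_range_powR a r : hub_range a `^ r = n%:R `^ ((3 - tau) * r) * a.+1%:R `^ (- r).
Proof.
by rewrite powRM ?powR_ge0 ?invr_ge0 // gt0_powRV ?ltr0n // powRrM.
Qed.

Lemma edge_ratio_le_range a b :
  w a * w b / elln tau C n <= c * hub_range a `^ al * b.+1%:R `^ (- al).
Proof.
apply: le_trans (edge_ratio_le a b) _; rewrite hub_range_powR -!mulrA.
have -> : (3 - tau) * al = 2 * al - 1.
  have [t2 t3] := andP tau23.
  by rewrite /alpha_of; field; rewrite gt_eqF //; lra.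
by [].
Qed.

Variables (pi lam : R).
Hypothesis pi01 : 0 <= pi <= 1.
Hypothesis piE : pi = lam * n%:R `^ (- eta_s tau).
Local Notation q := (qprob tau C pi).

(* [j^{-1/2}] is a positive super-solution of the expected adjacency kernel, with
   ratio of order [lam]: the splitting point [hub_range a] is where
   [w a * w b / elln] crosses 1. *)
Lemma kernel_bound a :
  \sum_b q a b * b.+1%:R `^ (- 2^-1) <= kernel_cst * lam * a.+1%:R `^ (- 2^-1).
Proof.
have [pi0 pi1] := andP pi01.
set M := hub_range a; have M0 : 0 < M := hub_range_gt0 a.
have b0 := beta_gt0.
rewrite (bigID (fun b : 'I_n => b.+1%:R <= M)) /=.
have h1 : \sum_(b : 'I_n | b.+1%:R <= M) q a b * b.+1%:R `^ (- 2^-1) <= pi * (2 * M `^ 2^-1).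
  apply: (@le_trans _ _ (\sum_(b : 'I_n | b.+1%:R <= M) pi * b.+1%:R `^ (- 2^-1))).
    by apply: ler_sum => b _; rewrite ler_wpM2r ?powR_ge0 // qprob_le_pi.
  by rewrite -mulr_sumr ler_wpM2l // sum_powR_head // ltW.
have h2 : \sum_(b : 'I_n | ~~ (b.+1%:R <= M)) q a b * b.+1%:R `^ (- 2^-1)
     <= pi * (c * zeta_cst beta * M `^ 2^-1).
  apply: (@le_trans _ _ (\sum_(b : 'I_n | M < b.+1%:R) pi * (c * M `^ al) * b.+1%:R `^ (-1 - beta))).
    rewrite (eq_bigl (fun b : 'I_n => M < b.+1%:R)); last by move=> b; rewrite -ltNge.
    apply: ler_sum => b _.
    have -> : -1 - beta = - al + - 2^-1 by rewrite /beta; field.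
    rewrite gt0_powRD ?ltr0n // mulrA ler_wpM2r ?powR_ge0 //.
    apply: le_trans (qprob_le _ _ _ _ pi01) _.
    by rewrite -[leRHS]mulrA ler_wpM2l // edge_ratio_le_range.
  rewrite -mulr_sumr -mulrA ler_wpM2l //.
  apply: le_trans (ler_wpM2l _ (sum_powR_tail n b0 M0)) _.
    by rewrite mulr_ge0 ?powR_ge0 ?(ltW cF_gt0).
  have -> : M `^ 2^-1 = M `^ al * M `^ (- beta).
    by rewrite -gt0_powRD //; congr (_ `^ _); rewrite /beta; ring.
  by rewrite /zeta_cst le_eqVlt; apply/orP; left; apply/eqP; ring.
apply: le_trans (lerD h1 h2) _.
rewrite -mulrDr -mulrDl -/kernel_cst hub_range_powR piE.
(* The square root of [hub_range a] contributes [n^(eta_s)], which cancels against [pi] and leaves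
   [lam]. *)
have -> : lam * n%:R `^ (- eta_s tau) * (kernel_cst * (n%:R `^ ((3 - tau) * 2^-1) * a.+1%:R `^ (- 2^-1))) =
  kernel_cst * lam * a.+1%:R `^ (- 2^-1) * (n%:R `^ (eta_s tau) * n%:R `^ (- eta_s tau)).
  by rewrite /eta_s; ring.
by rewrite gt0_powRK // mulr1.
Qed.

Hypothesis lam0 : 0 <= lam.
Hypothesis lam_small : kernel_cst * lam <= 2^-1.

(** Since [al > 1/2], [w] lies below the test function, and each step of the kernel at least halves
    that function: a geometric series of sum 2, uniformly in [m]. *)
Lemma Vsum_le m a : Vsum tau C pi m a <= 2 * c * n%:R `^ al * a.+1%:R `^ (- 2^-1).
Proof.
have wle b : w b <= c * n%:R `^ al * b.+1%:R `^ (- 2^-1).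
  rewrite weightE -mulrA ler_pM2l ?cF_gt0 // ler_pM2l ?powR_gt0 //.
  by apply: ler_powR; rewrite ?ler1n // lerN2 (ltW alpha_gt_half).
have cn0 : 0 <= c * n%:R `^ al by rewrite mulr_ge0 ?powR_ge0 ?(ltW cF_gt0).
elim: m a => [|m IH] a.
  rewrite /Vsum big_seq1 /= mul1r; apply: le_trans (wle a) _.
  by rewrite -!mulrA ler_peMl ?ler1n // !mulr_ge0 ?powR_ge0 ?(ltW cF_gt0).
rewrite VsumS.
apply: le_trans (lerD (wle a) (ler_sum _ (fun b _ => ler_wpM2l (qprob_ge0 _ _ _ _ pi01) (IH b)))) _.
under eq_bigr do rewrite mulrCA.
rewrite -mulr_sumr.
have h : 2 * c * n%:R `^ al * (\sum_b q a b * b.+1%:R `^ (- 2^-1)) <=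
         2 * c * n%:R `^ al * (2^-1 * a.+1%:R `^ (- 2^-1)).
  rewrite ler_wpM2l ?mulr_ge0 ?powR_ge0 ?(ltW cF_gt0) //.
  apply: le_trans (kernel_bound a) _.
  by rewrite ler_wpM2r ?powR_ge0.
apply: le_trans (lerD (lexx _) h) _.
by rewrite le_eqVlt; apply/orP; left; apply/eqP; field.
Qed.

(** One unfolding of the recursion isolates [w a] with the exact constant 1; [Vsum_le] is used only
    for the remainder, which gains the factor [lam]. *)
Lemma Vsum_le_hub a : Vsum tau C pi n a <=
  w a + kernel_cst * lam * (2 * c * n%:R `^ al).
Proof.
have -> : Vsum tau C pi n a = Vsum tau C pi n.-1.+1 a by rewrite prednK.
rewrite VsumS lerD2l.
have cn0 : 0 <= 2 * c * n%:R `^ al by rewrite !mulr_ge0 ?powR_ge0 ?(ltW cF_gt0).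
apply: le_trans (ler_sum _ (fun b _ => ler_wpM2l (qprob_ge0 _ _ _ _ pi01) (Vsum_le _ b))) _.
under eq_bigr do rewrite mulrCA.
rewrite -mulr_sumr [leRHS]mulrC ler_wpM2l //.
apply: le_trans (kernel_bound a) _.
rewrite ler_piMr ?mulr_ge0 ?(ltW kernel_cst_gt0) //.
apply: (@le_trans _ _ (a.+1%:R `^ 0)); last by rewrite powRr0.
by apply: ler_powR; rewrite ?ler1n // oppr_le0 invr_ge0.
Qed.

Lemma sum_weight_Vsum K : (0 < K)%N ->
  \sum_(a : 'I_n | (K <= a)%N) w a * Vsum tau C pi n a <=
  2 * c ^+ 2 * zeta_cst beta * (n%:R `^ al) ^+ 2 * K%:R `^ (- beta).
Proof.
move=> K0.
apply: (@le_trans _ _ (\sum_(a : 'I_n | K%:R < a.+1%:R :> R)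
    2 * c ^+ 2 * (n%:R `^ al) ^+ 2 * a.+1%:R `^ (- 1 - beta))).
  rewrite (eq_bigl (fun a : 'I_n => K%:R < a.+1%:R :> R)); last by move=> a; rewrite ltr_nat.
  apply: ler_sum => a _; apply: le_trans (ler_wpM2l (weight_ge0 _ _ _) (Vsum_le _ a)) _.
  have -> : -1 - beta = - al + - 2^-1 by rewrite /beta; field.
  by rewrite gt0_powRD ?ltr0n // weightE le_eqVlt; apply/orP; left; apply/eqP; ring.
rewrite -mulr_sumr.
have := @sum_powR_tail R beta n K%:R beta_gt0; rewrite ltr0n => /(_ K0) h.
apply: le_trans (ler_wpM2l _ h) _; first by rewrite !mulr_ge0 ?exprn_ge0 ?powR_ge0.
by rewrite /zeta_cst le_eqVlt; apply/orP; left; apply/eqP; ring.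
Qed.

End FixedSize.

(** The ratios [w k * w j / ell] sum to [w k]. Passing to [1 - exp] loses at most the sum of their
    [p]-th powers, and removing [j = k] loses one ratio; both losses are of order [n^g], uniformly
    in [k]. *)
Lemma sum_nr_prob_ge : exists D g : R, [/\ 0 <= D, g < al &
  forall n (k : 'I_n), w k - D * n%:R `^ g <= \sum_(j | j != k) nr_prob tau C k j].
Proof.
have a0 := alpha_gt_half; have a1 := alpha_lt1; have c0 := cF_gt0.
(* Chosen so that [1 / al < p <= 2], which makes [sum_j j^{- p al}] converge,
   and [(2 al - 1) p < al]. *)
pose p := al^-1 + (1 - al) ^+ 2 * (2 * al - 1).
have al0 := alpha_gt0.
have ali : 1 < al^-1 by rewrite invf_gt1 // alpha_lt1.
have sq0 : 0 < (1 - al) ^+ 2 by rewrite exprn_gt0 //; lra.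
have e0 : 0 < 2 * al - 1 by lra.
have pe : p * al - 1 = (1 - al) ^+ 2 * (2 * al - 1) * al by rewrite /p; field; rewrite gt_eqF.
have b0 : 0 < p * al - 1 by rewrite pe (mulr_gt0 (mulr_gt0 sq0 e0) al0).
have sq1 : (1 - al) ^+ 2 < 1 by rewrite expr2; nra.
have p1 : 1 <= p by rewrite /p; have := mulr_gt0 sq0 e0; lra.
have p2 : p <= 2.
  rewrite -(ler_pM2r al0).
  have -> : p * al = 1 + (1 - al) ^+ 2 * (2 * al - 1) * al by rewrite -pe; ring.
  have := mulr_gt0 e0 al0; nra.
have ga : (2 * al - 1) * p < al.
  rewrite -(ltr_pM2r al0) -mulrA.
  have -> : p * al = 1 + (1 - al) ^+ 2 * (2 * al - 1) * al by rewrite -pe; ring.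
  have : al * (2 * al - 1) ^+ 2 < 1.
    have : (2 * al - 1) ^+ 2 < 1 by rewrite expr2; nra.
    nra.
  nra.
pose D := c + c `^ p * (zeta_cst (p * al - 1) * 2^-1 `^ (- (p * al - 1))).
exists D, ((2 * al - 1) * p); split => //.
  rewrite addr_ge0 ?(ltW c0) // mulr_ge0 ?powR_ge0 // mulr_ge0 ?powR_ge0 //.
  exact: ltW (zeta_cst_gt0 b0).
move=> n k; have n0 : (0 < n)%N by case: k; case: n.
have nR1 : 1 <= n%:R :> R by rewrite ler1n.
have nR0 : 0 < n%:R :> R by rewrite ltr0n.
pose x (j : 'I_n) := w k * w j / elln tau C n.
have x0 j : 0 <= x j by rewrite mulr_ge0 ?invr_ge0 ?elln_ge0 // mulr_ge0 ?weight_ge0.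
have xle j : x j <= c * n%:R `^ (2 * al - 1) * j.+1%:R `^ (- al).
  apply: le_trans (edge_ratio_le n0 k j) _.
  rewrite ler_wpM2l ?mulr_ge0 ?powR_ge0 ?(ltW c0) // ler_piMl ?powR_ge0 //.
  apply: (@le_trans _ _ (k.+1%:R `^ 0)); last by rewrite powRr0.
  by apply: ler_powR; rewrite ?ler1n // oppr_le0 (ltW al0).
have xsum : \sum_j x j = w k.
  by rewrite /x -mulr_suml -mulr_sumr -mulrA divff ?mulr1 // gt_eqF // elln_gt0.
have xk : x k <= c * n%:R `^ ((2 * al - 1) * p).
  apply: le_trans (xle k) _; rewrite -mulrA ler_pM2l //.
  rewrite -[leRHS]mulr1 ler_pM ?powR_ge0 //.
    by apply: ler_powR => //; nra.
  apply: (@le_trans _ _ (k.+1%:R `^ 0)); last by rewrite powRr0.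
  by apply: ler_powR; rewrite ?ler1n // oppr_le0 (ltW al0).
have xp : \sum_j x j `^ p <= c `^ p * n%:R `^ ((2 * al - 1) * p) *
     (zeta_cst (p * al - 1) * 2^-1 `^ (- (p * al - 1))).
  (* The condition always holds; it only puts the full sum in the form of [sum_powR_tail] with
     [M = 1/2]. *)
  apply: (@le_trans _ _ (\sum_(j : 'I_n | 2^-1 < j.+1%:R :> R)
     c `^ p * n%:R `^ ((2 * al - 1) * p) * j.+1%:R `^ (-1 - (p * al - 1)))).
    rewrite (eq_bigl (fun j : 'I_n => 2^-1 < j.+1%:R :> R)); last first.
      by move=> j; apply/esym; apply: (@lt_le_trans _ _ 1); rewrite ?ler1n // invf_lt1 ?ltr1n.
    apply: ler_sum => j _.
    apply: (@le_trans _ _ ((c * n%:R `^ (2 * al - 1) * j.+1%:R `^ (- al)) `^ p)).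
      apply: ge0_ler_powR; rewrite ?nnegrE ?x0 //; first by lra.
      by rewrite !mulr_ge0 ?powR_ge0 ?(ltW c0).
    rewrite !powRM ?mulr_ge0 ?powR_ge0 ?(ltW c0) // -!powRrM.
    by have -> : -1 - (p * al - 1) = - al * p by ring.
  rewrite -mulr_sumr ler_wpM2l ?mulr_ge0 ?powR_ge0 //.
  by apply: sum_powR_tail => //; rewrite invr_gt0.
apply: (@le_trans _ _ (\sum_(j | j != k) (x j - x j `^ p))); last first.
  by apply: ler_sum => j _; apply: one_minus_expRN_ge; rewrite ?x0 ?p1.
rewrite sumrB.
have : \sum_(j | j != k) x j `^ p <= \sum_j x j `^ p.
  by rewrite [leRHS](bigD1 k) //= lerDr powR_ge0.
have : \sum_(j | j != k) x j = w k - x k.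
  by rewrite -xsum [in RHS](bigD1 k) //= [x k + _]addrC addrK.
move=> ->; rewrite /D; nra.
Qed.

End WeightEstimates.

(** * Ranking and asymptotics *)

(* The index is shifted: [hub om j] is the component of vertex [j + 1] of the paper. *)
Definition hub n (om : outcome n) (j : nat) : {set 'I_n} :=
  if insub j is Some x then component_of om x else finset.set0.

Lemma hubE n (om : outcome n) (x : 'I_n) : hub om x = component_of om x.
Proof. by rewrite /hub valK. Qed.

(** Ties are ordered arbitrarily, so a position is determined by sizes only when no other member has
    the size of [A]. *)
Lemma index_sorted_card n (l : seq {set 'I_n}) (A : {set 'I_n}) :
  sorted (fun A B : {set 'I_n} => #|B| <= #|A|)%N l -> A \in l ->
  (forall B, B \in l -> B != A -> #|B| != #|A|) ->
  index A l = count (fun B : {set 'I_n} => #|A| < #|B|)%N l.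
Proof.
elim: l => [|B l IH] //= pl; rewrite in_cons.
have trl : transitive (fun A B : {set 'I_n} => #|B| <= #|A|)%N.
  by move=> X Y Z XY YZ; exact: leq_trans YZ XY.
have lB := order_path_min trl pl.
have [<- _ _|BA] := eqVneq B A.
  rewrite ltnn add0n; apply/esym/eqP; rewrite -leqn0 leqNgt -has_count.
  by apply/hasPn => X Xl; rewrite -leqNgt; exact: (allP lB).
move=> /= Al dist.
have -> : (#|A| < #|B|)%N.
  by rewrite ltn_neqAle eq_sym dist ?mem_head //=; exact: (allP lB).
rewrite add1n (IH (path_sorted pl) Al) // => X Xl; apply: dist.
by rewrite in_cons Xl orbT.
Qed.

Lemma Cth_eq n (om : outcome n) (l : seq {set 'I_n}) (f : nat -> {set 'I_n}) i :
  (0 < i)%N -> sorted_components om l ->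
  (forall j, (j < i)%N -> f j \in components om) ->
  (forall j j', (j < j')%N -> (j' < i)%N -> (#|f j'| < #|f j|)%N) ->
  (forall A, A \in components om ->
     (exists2 j, (j < i)%N & A = f j) \/ (#|A| < #|f i.-1|)%N) ->
  Cth l i = f i.-1.
Proof.
case: i => // i _ [ul ml sl] fc fdec fA; rewrite /Cth /=.
have fil : f i \in l by rewrite ml fc.
have fdec' j j' : (j < j')%N -> (j' <= i)%N -> (#|f j'| < #|f j|)%N.
  by move=> jj' j'i; exact: fdec.
have finj j : (j < i)%N -> (#|f i| < #|f j|)%N by move=> ji; exact: fdec'.
suff idx : index (f i) l = i by rewrite -{1}idx nth_index.
rewrite index_sorted_card //; last first.
  move=> B; rewrite ml => /fA [[j jI ->]|/ltn_eqF -> //] ne.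
  have : (j < i)%N.
    by rewrite ltn_neqAle -ltnS jI andbT; apply: contraNneq ne => ->.
  by move/finj; rewrite ltn_neqAle eq_sym => /andP[].
(* The components strictly larger than [f i] are exactly [f 0], ..., [f (i - 1)], with [i] now the
   rank counted from 0. *)
rewrite -size_filter.
rewrite -[RHS](size_iota 0 i) -(size_map f).
apply/perm_size; apply: uniq_perm; first exact: filter_uniq.
  rewrite map_inj_in_uniq ?iota_uniq // => j j'; rewrite !mem_iota !add0n /= => ji j'i e.
  have [jj'|j'j|//] := ltngtP j j'.
    by have := fdec' j j' jj' (ltnW j'i); rewrite e ltnn.
  by have := fdec' j' j j'j (ltnW ji); rewrite e ltnn.
move=> B; rewrite mem_filter ml; apply/idP/idP.
  case/andP=> fB /fA [[j jI BE]|]; last by rewrite ltnNge ltnW.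
  apply/mapP; exists j => //; rewrite mem_iota add0n /= ltn_neqAle -ltnS jI andbT.
  by apply/eqP => ji; move: fB; rewrite BE ji ltnn.
case/mapP => j; rewrite mem_iota add0n /= => ji ->.
by rewrite finj // fc // ltnW.
Qed.

(** * Concentration at a fixed hub, and identification of the [i]-th largest component *)

Section Asymptotics.
Local Open Scope classical_set_scope.
Variables (R : realType) (tau C : R) (pi lam : nat -> R).
Hypothesis tau23 : 2 < tau < 3.
Hypothesis C0 : 0 < C.
Hypothesis pi01 : forall n, 0 <= pi n <= 1.
Hypothesis piE : forall n, pi n = lam n * (n%:R `^ (- eta_s tau)).
Hypothesis lam_cvg : lam @ \oo --> 0.
Hypothesis pi_cvg : (fun n => pi n * n%:R `^ alpha_of tau) @ \oo --> +oo.

Local Notation al := (alpha_of tau).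
Local Notation c := (cF tau C).
Local Notation w := (weight tau C).
Local Notation P n := (@Prob R tau C (pi n) n).
Local Notation Kc := (kernel_cst tau C).

Definition scale n : R := n%:R `^ al * pi n.
(** Indices start at 0: rank [i] has limit [hlim i.-1]. *)
Definition hlim (k : nat) : R := c * k.+1%:R `^ (- al).

Lemma near_powRN (b e : R) : 0 < b -> 0 < e -> \forall n \near \oo, n%:R `^ (- b) <= e.
Proof.
move=> b0 e0; near=> n.
have en : e `^ (- b^-1) <= n%:R by near: n; exact: nbhs_infty_ger.
have : n%:R `^ (- b) <= (e `^ (- b^-1)) `^ (- b).
  by apply: ler_powRN => //; [exact: ltW | exact: powR_gt0].
by rewrite -powRrM mulrNN mulVf ?gt_eqF // powRr1 ?(ltW e0).
Unshelve. all: by end_near. Qed.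

Lemma near_powR_o (g e : R) : g < al -> 0 < e ->
  \forall n \near \oo, n%:R `^ g <= e * n%:R `^ al.
Proof.
move=> ga e0; have b0 : 0 < al - g by rewrite subr_gt0.
near=> n.
have n0 : 0 < n%:R :> R by rewrite ltr0n; near: n; exact: nbhs_infty_gt.
have -> : g = - (al - g) + al by ring.
rewrite gt0_powRD // ler_pM2r ?powR_gt0 //.
by near: n; exact: near_powRN.
Unshelve. all: by end_near. Qed.

Lemma near_lam (e : R) : 0 < e -> \forall n \near \oo, (0 < n)%N /\ 0 <= lam n <= e.
Proof.
move=> e0; near=> n.
have n0 : (0 < n)%N by near: n; exact: nbhs_infty_gt.
split=> //; apply/andP; split.
  have [+ _] := andP (pi01 n); rewrite piE pmulr_lge0 // powR_gt0 // ltr0n //.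
have : `|0 - lam n| <= e by near: n; move/cvgrPdist_le : lam_cvg; exact.
by rewrite sub0r normrN; exact: le_trans (ler_norm _).
Unshelve. all: by end_near. Qed.

Lemma near_scale (A : R) : \forall n \near \oo, A <= scale n.
Proof.
move/cvgryPge : pi_cvg => /(_ A); apply: filterS => n.
by rewrite /scale mulrC.
Qed.

Lemma near_forall_lt (K : nat) (Q : nat -> nat -> Prop) :
  (forall j, \forall n \near \oo, Q j n) ->
  \forall n \near \oo, forall j, (j < K)%N -> Q j n.
Proof.
move=> HQ; elim: K => [|K IH]; first by near=> n.
near=> n => j; rewrite ltnS leq_eqVlt => /orP[/eqP->|jK].
  by near: n; exact: HQ.
by move: j jK; near: n.
Unshelve. all: by end_near. Qed.

Lemma hlim_gt0 k : 0 < hlim k.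
Proof. exact: mulr_gt0 (cF_gt0 tau C0) (powR_gt0 _ (ltr0Sn _ _)). Qed.

Lemma hlim_lt j k : (j < k)%N -> hlim k < hlim j.
Proof.
move=> jk; rewrite ltr_pM2l ?cF_gt0 // !powRN ltf_pV2 ?posrE ?powR_gt0 ?ltr0n //.
by apply: gt0_ltr_powR; rewrite ?nnegrE ?ltr_nat ?alpha_gt0.
Qed.

Lemma hlim_le j k : (j <= k)%N -> hlim k <= hlim j.
Proof. by rewrite leq_eqVlt => /orP[/eqP->|/hlim_lt/ltW]. Qed.

Lemma weight_hlim n (x : 'I_n) : (0 < n)%N -> w x = n%:R `^ al * hlim x.
Proof. by move=> n0; rewrite weightE // /hlim mulrCA. Qed.

(** The component contains its hub, so the excess over [w x] is nonnegative and a first moment bound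
    suffices. *)
Lemma hub_weight_cvg k (e h : R) : 0 < e -> 0 < h -> \forall n \near \oo,
  P n (fun om => e < `| Wof tau C (hub om k) / n%:R `^ al - hlim k |) <= h.
Proof.
move=> e0 h0; have c0 := cF_gt0 tau C0; have Kc0 := kernel_cst_gt0 tau23 C0.
(* The first bound on [lam] gives the contraction needed for [Vsum_le_hub], the second makes the
   mean excess at most [h * e * n^al]. *)
pose d := Num.min (2^-1 / Kc) (h * e / (2 * c * Kc)).
have d0 : 0 < d by rewrite lt_min !divr_gt0 ?mulr_gt0.
near=> n.
have [n0 /andP[l0 ld]] : (0 < n)%N /\ 0 <= lam n <= d by near: n; exact: near_lam.
have kn : (k < n)%N by near: n; exact: nbhs_infty_gt.
pose x := Ordinal kn; have nR0 : 0 < n%:R `^ al :> R by rewrite powR_gt0 ?ltr0n.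
move: ld; rewrite le_min => /andP[ld1 ld2].
have ls : Kc * lam n <= 2^-1 by rewrite mulrC -ler_pdivlMr.
have ls2 : Kc * lam n * (2 * c) <= h * e.
  by move: ld2; rewrite ler_pdivlMr ?mulr_gt0 //; lra.
have W0 (om : outcome n) : 0 <= Wof tau C (component_of om x) - w x.
  rewrite /Wof (bigD1 x) ?inE ?connect0 //= [_ + _ - _]addrAC subrr add0r.
  by apply: sumr_ge0 => j _; exact: weight_ge0.
apply: le_trans (@Prob_markov R tau C (pi n) n (pi01 n) _
  (fun om => Wof tau C (component_of om x) - w x) (e * n%:R `^ al) _ W0 _) _.
- by rewrite mulr_gt0.
- move=> om; rewrite -[k]/(val x) hubE => H.
  rewrite -ler_pdivlMr //; apply: le_trans (ltW H) _; rewrite ger0_norm.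
    by rewrite le_eqVlt weight_hlim //; apply/orP; left; apply/eqP; field; rewrite gt_eqF.
  by rewrite subr_ge0 ler_pdivlMr // mulrC -weight_hlim // -subr_ge0.
- rewrite ler_pdivrMr ?mulr_gt0 // (ExpD _ _ _ _ (fun=> - w x)) Exp_cst lerBlDr.
  apply: le_trans (Exp_Wof_component tau C (pi01 n) x) _.
  apply: le_trans (Vsum_le_hub tau23 C0 n0 (pi01 n) (piE n) l0 ls x) _.
  by rewrite addrC lerD2r mulrA [leRHS]mulrA ler_wpM2r.
Unshelve. all: by end_near. Qed.

(** The size is 1 plus the degree plus a nonnegative rest [Y]. Chebyshev controls the degree; [Y]
    has small mean because the upper bound for the mean size and the mean degree agree to leading
    order. *)
Lemma hub_size_cvg k (e h : R) : 0 < e -> 0 < h -> \forall n \near \oo,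
  P n (fun om => e < `| #|hub om k|%:R / scale n - hlim k |) <= h.
Proof.
move=> e0 h0; have c0 := cF_gt0 tau C0; have Kc0 := kernel_cst_gt0 tau23 C0.
have L0 := hlim_gt0 k.
have [D [g [D0 ga Hdef]]] := sum_nr_prob_ge tau23 C0.
pose d := Num.min (2^-1 / Kc) (h * e / 12 / (2 * c * Kc)).
have d0 : 0 < d by rewrite lt_min !divr_gt0 ?mulr_gt0.
pose r := Num.min (e / 6) (h * e / 12).
have r0 : 0 < r by rewrite lt_min !divr_gt0 ?mulr_gt0.
(* A scale above [6 / e] absorbs the hub itself, counted as 1; the second bound is what Chebyshev
   needs for probability [h / 2]. *)
pose A := Num.max (6 / e) (18 * hlim k / (e ^+ 2 * h)).
have D1 : 0 < D + 1 by rewrite ltr_wpDl.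
near=> n.
have [n0 /andP[l0 ld]] : (0 < n)%N /\ 0 <= lam n <= d by near: n; exact: near_lam.
have kn : (k < n)%N by near: n; exact: nbhs_infty_gt.
have Bn : A <= scale n by near: n; exact: near_scale.
have gn : n%:R `^ g <= r / (D + 1) * n%:R `^ al.
  by near: n; apply: near_powR_o => //; rewrite divr_gt0.
pose x := Ordinal kn; have nR0 : 0 < n%:R `^ al :> R by rewrite powR_gt0 ?ltr0n.
move: ld; rewrite le_min => /andP[ld1 ld2].
have ls : Kc * lam n <= 2^-1 by rewrite mulrC -ler_pdivlMr.
have ls2 : Kc * lam n * (2 * c) <= h * e / 12.
  by move: ld2; rewrite [in X in X -> _]ler_pdivlMr ?mulr_gt0 //; lra.
have [pi0 pi1] := andP (pi01 n).
set B := scale n in Bn *.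
have [A1 A2] : 6 / e <= B /\ 18 * hlim k / (e ^+ 2 * h) <= B.
  by move: Bn; rewrite ge_max => /andP.
have B0 : 0 < B by apply: lt_le_trans A1; rewrite divr_gt0.
have dn : D * n%:R `^ g <= r * n%:R `^ al.
  apply: (@le_trans _ _ (D * (r / (D + 1) * n%:R `^ al))); first by rewrite ler_wpM2l.
  rewrite mulrA ler_pM2r //.
  have -> : D * (r / (D + 1)) = r * (D / (D + 1)) by field; rewrite gt_eqF.
  by rewrite ler_piMr ?(ltW r0) // ler_pdivrMr // mul1r lerDl.
have re : r <= e / 6 by rewrite ge_min lexx.
have rh : r <= h * e / 12 by rewrite ge_min lexx orbT.
pose m := \sum_(j | j != x) qprob tau C (pi n) x j.
have mE : m = pi n * \sum_(j | j != x) nr_prob tau C x j.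
  by rewrite mulrC mulr_suml.
have wE : pi n * w x = B * hlim k by rewrite weight_hlim // /B /scale; ring.
have m_ge : B * hlim k - B * r <= m.
  rewrite mE -wE; apply: le_trans (ler_wpM2l pi0 (Hdef n x)).
  by rewrite mulrBr lerD2l lerN2 /B /scale; nra.
have m_le : m <= B * hlim k.
  rewrite -wE; apply: le_trans (sum_qprob_le tau C (pi01 n) x).
  by rewrite [leRHS](bigD1 x) //= lerDr qprob_ge0.
pose Y om := #|component_of om x|%:R - 1 - @deg R n om x.
have Y0 om : 0 <= Y om by rewrite subr_ge0 deg_lt_card_component_of.
have EY : @Exp R tau C (pi n) n Y <= B * (h * e / 6).
  have -> : @Exp R tau C (pi n) n Y =
    Exp tau C (pi n) (fun om => #|component_of om x|%:R - 1) + -1 * Exp tau C (pi n) (fun om => deg R om x).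
    by rewrite -ExpZ -ExpD; apply: eq_Exp => om; rewrite /Y; ring.
  rewrite Exp_deg -/m mulN1r.
  apply: le_trans (lerD (Exp_card_component_of tau C (pi01 n) x) (lexx _)) _.
  have := ler_wpM2l pi0 (Vsum_le_hub tau23 C0 n0 (pi01 n) (piE n) l0 ls x).
  rewrite mulrDr wE => hV; apply: le_trans (lerD hV (lexx _)) _.
  have -> : pi n * (Kc * lam n * (2 * c * n%:R `^ al)) = B * (Kc * lam n * (2 * c)).
    by rewrite /B /scale; ring.
  have := ler_wpM2l (ltW B0) ls2; have := ler_wpM2l (ltW B0) rh.
  by move: m_ge; lra.
(* Error budget in units of [B]: [e / 3] for [Y], [e / 3] for the degree around its mean [m],
   [e / 6] for [m] against [B * hlim k], and [e / 6] for the hub itself. *)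
pose E1 := fun om : outcome n => B * (e / 3) <= Y om.
pose E2 := fun om : outcome n => (B * (e / 3)) ^+ 2 <= (deg R om x - m) ^+ 2.
apply: (@le_trans _ _ (P n (fun om => E1 om || E2 om))).
  apply: le_Prob => // om; rewrite -[k]/(val x) hubE /= => H; apply/negPn/negP.
  rewrite negb_or /E1 /E2 -!ltNge => /andP[h1 h2].
  have Be : 0 < B * (e / 3) by rewrite mulr_gt0 // divr_gt0.
  have : `|deg R om x - m| < B * (e / 3).
    by rewrite -ltr_sqr ?nnegrE ?(ltW Be) // real_normK ?num_real.
  rewrite ltr_norml => /andP[h3 h4].
  have A3 : 1 <= B * (e / 6).
    by move: A1; rewrite ler_pdivrMr // => A1; lra.
  have r6 := ler_wpM2l (ltW B0) re.
  have cE : #|component_of om x|%:R = 1 + deg R om x + Y om by rewrite /Y; ring.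
  have Yom := Y0 om.
  move: H; rewrite ltNge => /negP; apply; rewrite ler_norml.
  rewrite lerBrDr lerBlDr ler_pdivlMr // ler_pdivrMr // cE.
  by apply/andP; split; lra.
apply: le_trans (Prob_or _ _ (pi01 n) _ _) _.
have Be : 0 < B * (e / 3) by rewrite mulr_gt0 // divr_gt0.
have p1 : P n E1 <= h / 2.
  apply: le_trans (@Prob_markov R tau C (pi n) n (pi01 n) E1 Y _ Be Y0 (fun=> id)) _.
  by rewrite ler_pdivrMr //; apply: le_trans EY _; rewrite le_eqVlt; apply/orP; left; apply/eqP; field.
have p2 : P n E2 <= h / 2.
  apply: le_trans (@Prob_markov R tau C (pi n) n (pi01 n) E2 _ _ _ (fun om => sqr_ge0 (deg R om x - m)) (fun=> id)) _.
    by rewrite exprn_gt0.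
  rewrite ler_pdivrMr ?exprn_gt0 //.
  apply: le_trans (deg_variance tau C (pi01 n) x) _; rewrite wE.
  have -> : h / 2 * (B * (e / 3)) ^+ 2 = B * (e ^+ 2 * h * B / 18) by field.
  rewrite ler_pM2l // ler_pdivlMr // mulrC.
  by move: A2; rewrite ler_pdivrMr ?mulr_gt0 ?exprn_gt0 // [B * _]mulrC.
by apply: le_trans (lerD p1 p2) _; rewrite -splitr.
Unshelve. all: by end_near. Qed.

Definition big_avoiding n (om : outcome n) (K : nat) (t : R) : bool :=
  [exists A : {set 'I_n}, [&& A \in components om, [forall x in A, (K <= x)%N] & t < #|A|%:R]].

(** Markov for [long_paths]: its mean is of order [scale n ^+ 2 * K^(- beta)], so [K] can be fixed
    before [n]. *)
Lemma small_components (e h : R) : 0 < e -> 0 < h -> exists K, \forall n \near \oo,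
  P n (fun om => big_avoiding om K (e * scale n)) <= h.
Proof.
move=> e0 h0; have c0 := cF_gt0 tau C0; have Kc0 := kernel_cst_gt0 tau23 C0.
have b0 := beta_gt0 tau23; have z0 := zeta_cst_gt0 b0.
pose Z := 16 * c ^+ 2 * zeta_cst (beta tau).
have Z0 : 0 < Z by rewrite mulr_gt0 // mulr_gt0 // exprn_gt0.
have [K [K0 hK]] : exists K, (0 < K)%N /\ K%:R `^ (- beta tau) <= h * e ^+ 2 / Z.
  have : \forall K \near \oo, (0 < K)%N /\ K%:R `^ (- beta tau) <= h * e ^+ 2 / Z.
    near=> K; split; first by near: K; exact: nbhs_infty_gt.
    by near: K; apply: near_powRN => //; rewrite divr_gt0 // mulr_gt0 // exprn_gt0.
  by case=> K _ HK; exists K; exact: (HK K (leqnn _)).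
exists K; near=> n.
have [n0 /andP[l0 ld]] : (0 < n)%N /\ 0 <= lam n <= 2^-1 / Kc.
  by near: n; apply: near_lam; rewrite divr_gt0.
have Bn : 4 / e <= scale n by near: n; exact: near_scale.
have ls : Kc * lam n <= 2^-1 by rewrite mulrC -ler_pdivlMr.
set B := scale n in Bn *.
have B0 : 0 < B by apply: lt_le_trans Bn; rewrite divr_gt0.
have Be : 4 <= e * B by move: Bn; rewrite ler_pdivrMr // mulrC.
(* A component of size [s >= 4] forces [s * (s - 2) / 4 >= s ^+ 2 / 8] long paths. This 8, times the
   2 in [sum_weight_Vsum], is the 16 in [Z]. *)
pose t := (e * B) ^+ 2 / 8.
have t0 : 0 < t by rewrite divr_gt0 // exprn_gt0 // mulr_gt0.
apply: le_trans (@Prob_markov R tau C (pi n) n (pi01 n) _ (@long_paths R n K) t t0 _ _) _.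
- move=> om; apply: sumr_ge0 => j _; apply: sumr_ge0 => k _; apply: sumr_ge0 => a _.
  exact: sumr_ge0.
- move=> om /existsP[X /and3P[Xc /forall_inP XK tX]].
  have := card_component_long_paths R Xc XK.
  have s4 : (4 <= #|X|)%N by rewrite -(ler_nat R); apply: le_trans Be (ltW tX).
  rewrite natrM natrB; last exact: leq_trans s4.
  have s4R : 4 <= #|X|%:R :> R by rewrite (ler_nat R 4).
  rewrite /t ler_pdivrMr //.
  have : (e * B) ^+ 2 <= #|X|%:R ^+ 2 by rewrite ler_sqr ?nnegrE ?(ltW tX) // ltW // mulr_gt0.
  by nra.
- rewrite ler_pdivrMr //.
  apply: le_trans (@Exp_long_paths R tau C (pi n) n (pi01 n) K) _.
  apply: le_trans (ler_wpM2l _ (sum_weight_Vsum tau23 C0 n0 (pi01 n) (piE n) ls K0)) _.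
    exact: sqr_ge0.
  have -> : pi n ^+ 2 * (2 * c ^+ 2 * zeta_cst (beta tau) * (n%:R `^ al) ^+ 2 * K%:R `^ (- beta tau))
     = (K%:R `^ (- beta tau) * Z) * (B ^+ 2 / 8) by rewrite /B /scale /Z; field.
  have -> : h * t = h * e ^+ 2 * (B ^+ 2 / 8) by rewrite /t; field.
  by rewrite ler_wpM2r ?divr_ge0 ?sqr_ge0 // -ler_pdivlMr.
Unshelve. all: by end_near. Qed.

(** With this [d], hub sizes within [d] of their limits stay strictly ordered. *)
Lemma hlim_gap i : exists2 d, 0 < d & forall j, (j < i)%N -> 2 * d < hlim j - hlim j.+1.
Proof.
elim: i => [|i [d d0 Hd]]; first by exists 1.
have gi : 0 < hlim i - hlim i.+1 by rewrite subr_gt0 hlim_lt.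
exists (Num.min d ((hlim i - hlim i.+1) / 4)); first by rewrite lt_min d0 divr_gt0.
move=> j; rewrite ltnS leq_eqVlt => /orP[/eqP->|ji].
  have : Num.min d ((hlim i - hlim i.+1) / 4) <= (hlim i - hlim i.+1) / 4 by rewrite ge_min lexx orbT.
  by lra.
apply: le_lt_trans (Hd j ji); rewrite ler_pM2l // ge_min lexx //.
Qed.

Variable rule : forall n : nat, outcome n -> seq {set 'I_n}.
Hypothesis ruleP : forall n (om : outcome n), sorted_components om (rule om).

Lemma Cth_hub i (h : R) : (0 < i)%N -> 0 < h -> \forall n \near \oo,
  P n (fun om => Cth (rule om) i != hub om i.-1) <= h.
Proof.
move=> i0 h0; have [d d0 Hd] := hlim_gap i.
have h20 : 0 < h / 2 by rewrite divr_gt0.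
have [K HK] := small_components d0 h20.
(* The controlled hubs must include the first [i] as well as every vertex below [K]; [eta] shares
   [h / 2] among them. *)
pose K' := (K + i)%N.
have K'0 : (0 < K')%N by rewrite addn_gt0 i0 orbT.
pose eta := h / 2 / K'%:R.
have eta0 : 0 < eta by rewrite divr_gt0 // ltr0n.
near=> n.
have nK : (K' <= n)%N by near: n; exact: nbhs_infty_ge.
have Bn : 1 <= scale n by near: n; exact: near_scale.
have hK : P n (fun om => big_avoiding om K (d * scale n)) <= h / 2 by near: n.
have hs : forall j, (j < K')%N ->
    P n (fun om => d < `| #|hub om j|%:R / scale n - hlim j |) <= eta.
  by near: n; apply: near_forall_lt => j; exact: hub_size_cvg.
set B := scale n in Bn hK hs *.
have B0 : 0 < B by apply: lt_le_trans Bn.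
pose bad j (om : outcome n) := d < `| #|hub om j|%:R / B - hlim j |.
apply: (@le_trans _ _ (P n (fun om => has (bad^~ om) (iota 0 K') || big_avoiding om K (d * B)))).
  apply: le_Prob => // om; apply: contraNT; rewrite negb_or => /andP[/hasPn good noA].
  have sz j : (j < K')%N -> B * (hlim j - d) <= #|hub om j|%:R <= B * (hlim j + d).
    move=> jK; have := good j; rewrite mem_iota add0n jK => /(_ isT).
    rewrite /bad -leNgt ler_norml lerBrDr lerBlDr ler_pdivlMr // ler_pdivrMr //.
    by move=> /andP[u1 u2]; apply/andP; split; lra.
  have iK j : (j < i)%N -> (j < K')%N by move/leq_trans; apply; exact: leq_addl.
  have i1 : (i.-1 < i)%N by rewrite prednK.
  have Hi := Hd i.-1 i1; rewrite prednK // in Hi.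
  have gap x y : x + 2 * d < y -> B * (x + d) < B * (y - d) by move=> xy; rewrite ltr_pM2l //; lra.
  apply/eqP; apply: (Cth_eq i0 (ruleP om)).
  - move=> j ji; have jn : (j < n)%N := leq_trans (iK j ji) nK.
    by rewrite -[j]/(val (Ordinal jn)) hubE component_ofP.
  - move=> j j' jj' j'i; rewrite -(ltr_nat R).
    have /andP[_ u1] := sz j' (iK _ j'i).
    have /andP[u2 _] := sz j (iK _ (ltn_trans jj' j'i)).
    apply: le_lt_trans u1 (lt_le_trans _ u2); apply: gap.
    by have := Hd j (ltn_trans jj' j'i); have := hlim_le jj'; lra.
  - move=> X Xc; have /andP[u2 _] := sz i.-1 (iK _ i1).
    (* A component meeting the first [K'] vertices is one of the controlled hub components; any
       other avoids the first [K] and has size at most [d * B]. *)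
    have [/existsP[x /andP[xX xK]]|/existsPn XK] := boolP [exists x, (x \in X) && (x < K')%N].
      have XE : X = hub om x by rewrite hubE; exact: components_eq.
      have [xi|ix] := ltnP x i; [by left; exists x|right].
      rewrite -(ltr_nat R) XE; have /andP[_ u1] := sz x xK.
      apply: le_lt_trans u1 (lt_le_trans _ u2); apply: gap.
      by have := hlim_le ix; lra.
    right; rewrite -(ltr_nat R); apply: lt_le_trans u2.
    have : #|X|%:R <= d * B.
      rewrite leNgt; apply/negP => tX; move/negP: noA; apply; apply/existsP; exists X.
      rewrite Xc tX andbT /=; apply/forall_inP => x xX.
      by have := XK x; rewrite xX -leqNgt; apply: leq_trans; exact: leq_addr.
    (* The gap gives [hlim i.-1 > 2 * d], so [d < hlim i.-1 - d]. *)
    move=> uX; apply: le_lt_trans uX _; rewrite mulrC ltr_pM2l //.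
    by have := hlim_gt0 i; lra.
apply: le_trans (Prob_or _ _ (pi01 n) _ _) _.
have p1 : P n (fun om => has (bad^~ om) (iota 0 K')) <= h / 2.
  apply: le_trans (Prob_has _ _ (pi01 n) _ _) _.
  rewrite big_seq_cond; apply: (@le_trans _ _ (\sum_(j <- iota 0 K' | (j \in iota 0 K') && true) eta)).
    by apply: ler_sum => j; rewrite mem_iota add0n andbT => /hs.
  rewrite -big_seq_cond big_const_seq count_predT size_iota iter_addr_0 -[eta *+ _]mulr_natr /eta.
  by rewrite divfK // pnatr_eq0 -lt0n.
by apply: le_trans (lerD p1 hK) _; rewrite -splitr.
Unshelve. all: by end_near. Qed.

(** Replacing the [i]-th component by the hub costs only the probability in [Cth_hub]; the generic
    [T] serves sizes and weights alike. *)
Lemma Prob_Cth_cvg0 i (T : forall n, outcome n -> {set 'I_n} -> bool) : (0 < i)%N ->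
  (forall h, 0 < h -> \forall n \near \oo, P n (fun om => T n om (hub om i.-1)) <= h) ->
  (fun n => P n (fun om => T n om (Cth (rule om) i))) @ \oo --> 0.
Proof.
move=> i0 HT; apply/cvgrPdist_le => h h0; have h20 : 0 < h / 2 by rewrite divr_gt0.
near=> n; rewrite sub0r normrN ger0_norm ?Prob_ge0 //.
apply: (@le_trans _ _ (P n (fun om => (Cth (rule om) i != hub om i.-1) || T n om (hub om i.-1)))).
  by apply: le_Prob => // om; case: eqP => [->|].
apply: le_trans (Prob_or _ _ (pi01 n) _ _) _.
rewrite [leRHS]splitr lerD //; near: n; [exact: Cth_hub | exact: HT].
Unshelve. all: by end_near. Qed.

End Asymptotics.

Local Open Scope classical_set_scope.

Theorem theorem2p1 (R : realType) (tau C : R) (pi lam : nat -> R)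
  (rule : forall n : nat, outcome n -> seq {set 'I_n}) :
  2 < tau < 3 -> 0 < C ->
  (forall n, 0 <= pi n <= 1) ->
  (forall n, pi n = lam n * (n%:R `^ (- eta_s tau))) ->
  lam @ \oo --> 0 ->
  (fun n => pi n * n%:R `^ alpha_of tau) @ \oo --> +oo ->
  (forall n (om : outcome n), sorted_components om (rule n om)) ->
  forall i : nat, (0 < i)%N ->
  (forall eps : R, 0 < eps ->
     (fun n => Prob tau C (pi n)
        (fun om => eps < `| (#|Cth (rule n om) i|)%:R / (n%:R `^ alpha_of tau * pi n)
                             - cF tau C * i%:R `^ (- alpha_of tau) |)) @ \oo --> 0)
  /\
  (forall eps : R, 0 < eps ->
     (fun n => Prob tau C (pi n)
        (fun om => eps < `| Wof tau C (Cth (rule n om) i) / n%:R `^ alpha_of tau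
                             - cF tau C * i%:R `^ (- alpha_of tau) |)) @ \oo --> 0).
Proof.
move=> tau23 C0 pi01 piE lam_cvg pi_cvg ruleP i i0; split=> eps eps0.
- apply: (Prob_Cth_cvg0 tau23 C0 pi01 piE lam_cvg pi_cvg ruleP (T := fun n _ A => eps < `| #|A|%:R /
     (n%:R `^ alpha_of tau * pi n) - cF tau C * i%:R `^ (- alpha_of tau) |) i0) => h h0.
  have := hub_size_cvg tau23 C0 pi01 piE lam_cvg pi_cvg i.-1 eps0 h0.
  by rewrite /hlim prednK.
- apply: (Prob_Cth_cvg0 tau23 C0 pi01 piE lam_cvg pi_cvg ruleP (T := fun n _ A => eps < `| Wof tau C A /
     n%:R `^ alpha_of tau - cF tau C * i%:R `^ (- alpha_of tau) |) i0) => h h0.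
  have := hub_weight_cvg tau23 C0 pi01 piE lam_cvg i.-1 eps0 h0.
  by rewrite /hlim prednK.
Qed.
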